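(* Let $\mathbf{k}$ be a field, $X=\{x_1,\dots,x_n\}$ with $n\ge2$, $f\in\mathrm{Sym}(X)$, let $(X,r_f)$ be the corresponding permutation idempotent solution, $\mathcal{A}=\mathcal{A}(\mathbf{k},X,r_f)$ its Yang-Baxter algebra, and $\mathcal{A}^+=\mathcal{A}_1\oplus\mathcal{A}_2\oplus\cdots$. The left annihilator $\mathrm{Ann}_{\mathcal{A}}(\mathcal{A}^+)$ is the left ideal of $\mathcal{A}$ generated by the elements $x_i-x_{i+1}$, $1\le i\le n-1$. Moreover, it is a free left module of rank $n-1$ over the commutative polynomial ring $\mathbf{k}[x_1]$ with free left basis $\{x_i-x_{i+1}\mid 1\le i\le n-1\}$: $$\mathrm{Ann}_{\mathcal{A}}(\mathcal{A}^+)=\bigoplus_{1\le i\le n-1}\mathbf{k}[x_1](x_i-x_{i+1}).$$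
   Context: For $f\in\mathrm{Sym}(X)$ the permutation idempotent solution is $r_f(x,y)=(f(y),y)$ on $X\times X$, and its Yang-Baxter algebra is $\mathcal{A}(\mathbf{k},X,r_f)=\mathbf{k}\langle X\rangle/(xy-f(y)y\mid x,y\in X)$, where $\mathbf{k}\langle X\rangle$ is the free unital associative algebra on $X$; it is graded by word length, $\mathcal{A}=\bigoplus_{d\ge0}\mathcal{A}_d$ with $\mathcal{A}_0=\mathbf{k}$. $\mathbf{k}[x_1]$ denotes the subalgebra of $\mathcal{A}$ generated by $x_1$, which is a polynomial algebra in one variable. The left annihilator of a subset $S\subseteq\mathcal{A}$ is $\mathrm{Ann}_{\mathcal{A}}(S)=\{a\in\mathcal{A}\mid ab=0\ \forall b\in S\}$. *)

(* Defs.v *)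
From HB Require Import structures.
From mathcomp Require Import all_boot all_order perm all_algebra.
From mathcomp Require Import boolp classical_sets.
From mathcomp Require Import finmap monalg.

Set Implicit Arguments.
Unset Strict Implicit.
Unset Printing Implicit Defensive.

Import GRing.Theory.
Local Open Scope ring_scope.
Local Open Scope classical_set_scope.
Local Open Scope quotient_scope.

Section RingSubsets.
Variable R : pzRingType.
Implicit Types (S J K M : set R) (a b : R).

Definition left_ideal J :=
  [/\ J 0, forall a b, J a -> J b -> J (a + b) & forall a b, J b -> J (a * b)].

Definition two_sided_ideal J :=
  left_ideal J /\ forall a b, J a -> J (a * b).

Definition left_ideal_gen S : set R := smallest left_ideal S.

Definition left_annihilator S : set R :=
  [set a | forall b, S b -> a * b = 0].

Definition left_submodule K M :=
  [/\ M 0, forall a b, M a -> M b -> M (a + b)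
    & forall c a, K c -> M a -> M (c * a)].

(* [M] is a free left module of rank [#|I|] over the subring [K], with basis
   [b]: every element of [M] has unique coordinates in [K]. *)
Definition free_left_basis K M (I : finType) (b : I -> R) :=
  [/\ left_submodule K M, forall i, M (b i)
    & forall m, M m -> exists! c : {ffun I -> R},
        (forall i, K (c i)) /\ m = \sum_i c i * b i].

Definition internal_direct_sum M (I : finType) (N : I -> set R) :=
  M = [set \sum_i c i | c in [set c : {ffun I -> R} | forall i, N i (c i)]] /\
  forall c c' : {ffun I -> R},
    (forall i, N i (c i)) -> (forall i, N i (c' i)) ->
    \sum_i c i = \sum_i c' i -> c = c'.

End RingSubsets.

Section AlgSubsets.
Variables (k : comNzRingType) (A : algType k).

Definition subalgebra_gen (S : set A) : set A :=
  smallest (fun B : set A => GRing.subalg_closed (mem B)) S.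

(* Evaluation at [x] identifies the abstract polynomial algebra [{poly k}]
   with the set [K]. *)
Definition polynomial_subalgebra (x : A) (K : set A) :=
  injective (horner_alg x) /\ range (horner_alg x) = K.

End AlgSubsets.

Section FreeAlgebra.
Variables (k : fieldType) (X : choiceType).

(* k<X>, the monoid algebra of the free monoid of words over [X] *)
Definition free_algebra : Type := {malg k[{fmonom X}]}.

HB.instance Definition _ := GRing.Lalgebra.on free_algebra.

Fact free_algebra_scalerAr (c : k) (p q : free_algebra) :
  c *: (p * q) = p * (c *: q).
Proof.
have comC : c%:MP * p = p * c%:MP.
  rewrite mul_malgC malgZ_def malgM_def fgmulgU.
  by apply: eq_bigr => w _; rewrite mulm1 mulrC.
by rewrite -[c *: q]mul_malgC mulrA -comC mul_malgC scalerAl.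
Qed.

HB.instance Definition _ :=
  GRing.Lalgebra_isAlgebra.Build k free_algebra free_algebra_scalerAr.

Definition free_gen (x : X) : free_algebra := << fmu x >>.

Definition homogeneous (d : nat) (p : free_algebra) :=
  forall w, w \in msupp p -> fdeg w = d.

End FreeAlgebra.

Section YangBaxterAlgebra.
Variables (k : fieldType) (X : choiceType) (r : X * X -> X * X).
Local Notation F := (free_algebra k X).
Implicit Types (p q : F).

Definition yb_relations : set F :=
  [set free_gen k z.1 * free_gen k z.2
       - free_gen k (r z).1 * free_gen k (r z).2 | z in [set: X * X]].

Definition yb_ideal : set F := smallest (@two_sided_ideal F) yb_relations.

Fact yb_ideal_two_sided : two_sided_ideal yb_ideal.
Proof.
split; first split.
- by move=> J [[[]]].
- move=> p q Ip Iq J JP; have [[[_ addJ _] _] _] := JP.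
  by apply: addJ; [apply: Ip | apply: Iq].
- move=> p q Iq J JP; have [[[_ _ mulJ] _] _] := JP.
  by apply: mulJ; apply: Iq.
- move=> p q Ip J JP; have [[_ mulJ] _] := JP.
  by apply: mulJ; apply: Ip.
Qed.

Definition yb_ideal_pred : {pred F} := fun p => `[< yb_ideal p >].

Fact yb_ideal_zmod_closed : zmod_closed yb_ideal_pred.
Proof.
have [[I0 ID IM] _] := yb_ideal_two_sided.
split=> [|p q /asboolP Ip /asboolP Iq]; apply/asboolP => //.
by apply: ID => //; rewrite -mulN1r; apply: IM.
Qed.

HB.instance Definition _ :=
  GRing.isZmodClosed.Build F yb_ideal_pred yb_ideal_zmod_closed.

Definition yb_algebra : Type := Quotient.quot yb_ideal_pred.

HB.instance Definition _ := GRing.Zmodule.on yb_algebra.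

Definition yb_pi : F -> yb_algebra := \pi_(Quotient.quot yb_ideal_pred).

Fact yb_piP p q : yb_pi p = yb_pi q <-> yb_ideal (p - q).
Proof.
split=> [/eqP | Ipq]; first by rewrite -Quotient.idealrBE => /asboolP.
by apply/eqP; rewrite -Quotient.idealrBE; apply/asboolP.
Qed.

Definition yb_repr (a : yb_algebra) : F :=
  generic_quotient.repr (a : Quotient.quot yb_ideal_pred).

Fact yb_reprK : cancel yb_repr yb_pi.
Proof. exact: reprK. Qed.

Fact yb_pi_is_zmod_morphism : zmod_morphism yb_pi.
Proof. by move=> p q; rewrite /yb_pi; rewrite !piE. Qed.

HB.instance Definition _ :=
  GRing.isZmodMorphism.Build F yb_algebra yb_pi yb_pi_is_zmod_morphism.

Definition yb_one : yb_algebra := yb_pi 1.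
Definition yb_mul (a b : yb_algebra) : yb_algebra :=
  yb_pi (yb_repr a * yb_repr b).
Definition yb_scale (c : k) (a : yb_algebra) : yb_algebra :=
  yb_pi (c *: yb_repr a).

Fact yb_pi_mul p q : yb_pi (p * q) = yb_mul (yb_pi p) (yb_pi q).
Proof.
have [[_ ID IM] IMr] := yb_ideal_two_sided.
apply/yb_piP; set p' := yb_repr _; set q' := yb_repr _.
have -> : p * q - p' * q' = (p - p') * q + p' * (q - q').
  by rewrite mulrBl mulrBr addrA subrK.
by apply: ID; [apply: IMr | apply: IM]; apply/yb_piP; rewrite yb_reprK.
Qed.

Fact yb_pi_scale c p : yb_pi (c *: p) = yb_scale c (yb_pi p).
Proof.
have [[_ _ IM] _] := yb_ideal_two_sided.
apply/yb_piP; rewrite -scalerBr -[_ - _]mul1r scalerAl.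
by apply: IM; apply/yb_piP; rewrite yb_reprK.
Qed.

Fact yb_mulA : associative yb_mul.
Proof.
move=> a b c; rewrite -[a]yb_reprK -[b]yb_reprK -[c]yb_reprK.
by rewrite -!yb_pi_mul mulrA.
Qed.

Fact yb_mul1 : left_id yb_one yb_mul.
Proof. by move=> a; rewrite -[a]yb_reprK -yb_pi_mul mul1r. Qed.

Fact yb_mulr1 : right_id yb_one yb_mul.
Proof. by move=> a; rewrite -[a]yb_reprK -yb_pi_mul mulr1. Qed.

Fact yb_mulDl : left_distributive yb_mul +%R.
Proof.
move=> a b c; rewrite -[a]yb_reprK -[b]yb_reprK -[c]yb_reprK.
by rewrite -raddfD -!yb_pi_mul mulrDl raddfD.
Qed.

Fact yb_mulDr : right_distributive yb_mul +%R.
Proof.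
move=> a b c; rewrite -[a]yb_reprK -[b]yb_reprK -[c]yb_reprK.
by rewrite -raddfD -!yb_pi_mul mulrDr raddfD.
Qed.

(* The relations have no constant term, so the ideal is proper. *)
Fact yb_one_neq0 : yb_one != 0.
Proof.
apply/eqP; rewrite /yb_one -[0 in RHS](raddf0 yb_pi) => /yb_piP; rewrite subr0.
pose J : set F := [set p : F | p@_(mone : {fmonom X}) = 0].
have JP : two_sided_ideal J.
  split; first split; rewrite /J /=.
  - exact: mcoeff0.
  - by move=> p q p0 q0; rewrite mcoeffD p0 q0 addr0.
  - by move=> p q q0; rewrite (rmorphM (mcoeff (mone : {fmonom X}))) /= q0 mulr0.
  - by move=> p q p0; rewrite (rmorphM (mcoeff (mone : {fmonom X}))) /= p0 mul0r.
have genJ x : (free_gen k x)@_(mone : {fmonom X}) = 0.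
  by rewrite mcoeffU1 fm1_eq1.
have relJ : yb_relations `<=` J.
  move=> _ [z _ <-]; rewrite /J /= mcoeffB.
  by rewrite !(rmorphM (mcoeff (mone : {fmonom X}))) /= !genJ !mul0r subrr.
move=> /(_ J (conj JP relJ)) /eqP.
by rewrite mcoeff1 eqxx oner_eq0.
Qed.

HB.instance Definition _ :=
  GRing.Zmodule_isNzRing.Build yb_algebra
    yb_mulA yb_mul1 yb_mulr1 yb_mulDl yb_mulDr yb_one_neq0.

Fact yb_scaleA c d a : yb_scale c (yb_scale d a) = yb_scale (c * d) a.
Proof. by rewrite -[a]yb_reprK -!yb_pi_scale scalerA. Qed.

Fact yb_scale1 : left_id 1 yb_scale.
Proof. by move=> a; rewrite -[a]yb_reprK -yb_pi_scale scale1r. Qed.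

Fact yb_scaleDr : right_distributive yb_scale +%R.
Proof.
move=> c a b; rewrite -[a]yb_reprK -[b]yb_reprK.
by rewrite -raddfD -!yb_pi_scale scalerDr raddfD.
Qed.

Fact yb_scaleDl a : {morph yb_scale^~ a : c d / c + d}.
Proof.
by move=> c d; rewrite -[a]yb_reprK -!yb_pi_scale scalerDl raddfD.
Qed.

HB.instance Definition _ :=
  GRing.Zmodule_isLmodule.Build k yb_algebra
    yb_scaleA yb_scale1 yb_scaleDr yb_scaleDl.

Fact yb_scalerAl (c : k) (a b : yb_algebra) : c *: (a * b) = (c *: a) * b.
Proof.
rewrite -[a]yb_reprK -[b]yb_reprK; set p := yb_repr a; set q := yb_repr b.
change (yb_scale c (yb_mul (yb_pi p) (yb_pi q)) =
        yb_mul (yb_scale c (yb_pi p)) (yb_pi q)).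
by rewrite -yb_pi_mul -!yb_pi_scale -yb_pi_mul scalerAl.
Qed.

HB.instance Definition _ :=
  GRing.LSemiModule_isLSemiAlgebra.Build k yb_algebra yb_scalerAl.

Fact yb_scalerAr (c : k) (a b : yb_algebra) : c *: (a * b) = a * (c *: b).
Proof.
rewrite -[a]yb_reprK -[b]yb_reprK; set p := yb_repr a; set q := yb_repr b.
change (yb_scale c (yb_mul (yb_pi p) (yb_pi q)) =
        yb_mul (yb_pi p) (yb_scale c (yb_pi q))).
by rewrite -yb_pi_mul -!yb_pi_scale -yb_pi_mul scalerAr.
Qed.

HB.instance Definition _ :=
  GRing.Lalgebra_isAlgebra.Build k yb_algebra yb_scalerAr.

Fact yb_pi_is_monoid_morphism : monoid_morphism yb_pi.
Proof. by split=> // p q; rewrite yb_pi_mul. Qed.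

HB.instance Definition _ :=
  GRing.isMonoidMorphism.Build F yb_algebra yb_pi yb_pi_is_monoid_morphism.

Fact yb_pi_is_scalable : scalable yb_pi.
Proof. by move=> c p; rewrite yb_pi_scale. Qed.

HB.instance Definition _ :=
  GRing.isScalable.Build k F yb_algebra *:%R yb_pi yb_pi_is_scalable.

Definition yb_gen (x : X) : yb_algebra := yb_pi (free_gen k x).

Definition yb_component (d : nat) : set yb_algebra :=
  [set yb_pi p | p in [set p | homogeneous d p]].

(* The positive part: finite sums of elements of components of degree >= 1 *)
Definition yb_pos : set yb_algebra :=
  [set a | exists (N : nat) (c : nat -> yb_algebra),
     (forall d, yb_component d (c d)) /\ a = \sum_(1 <= d < N) c d].

End YangBaxterAlgebra.

Arguments yb_component k {X} r d _.
Arguments yb_pos k {X} r _.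

Definition perm_idempotent_solution (X : finType) (f : {perm X}) :
  X * X -> X * X := fun z => (f z.2, z.2).

Definition ord_low (n : nat) (i : 'I_n.-1) : 'I_n := widen_ord (leq_pred n) i.

Fact ord_high_proof (n : nat) (i : 'I_n.-1) : (i.+1 < n)%N.
Proof. by rewrite -ltn_predRL. Qed.

Definition ord_high (n : nat) (i : 'I_n.-1) : 'I_n :=
  Ordinal (ord_high_proof i).

(* Main.v *)
Require Import Defs.
From HB Require Import structures.
From mathcomp Require Import all_boot all_order perm all_algebra.
From mathcomp Require Import boolp classical_sets.
From mathcomp Require Import finmap monalg.

(** The relations read [x_y x_t = x_(f t) x_t], so [x_y x_t] does not depend
    on [y]; the permutation [f] disappears from the presentation.  Hence every
    nonempty word equals some [x_0^m x_t], where [x_0] is a fixed generator,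
    and every element of the algebra has the form [c + sum_y p_y(x_0) x_y]
    with polynomials [p_y] ([normal_form]).

    This form is unique on the positive part.  For any weight [w] on the
    generators, the 2x2 matrices with rows [('X, w y)] and [(0, 0)] satisfy the
    relations, and reading off the upper right entry gives an additive form
    [lam] with [lam (p(x_0) x_y) = p * w y] ([linear_form]).  In particular
    [x_0] generates a polynomial algebra.

    An element [a] annihilates the positive part as soon as it annihilates the
    generators ([annihilator_posP]).  Since [a x_0 = (c + (sum_y p_y) 'X) 'X]
    evaluated at [x_0], this forces [c = 0] and [sum_y p_y = 0]
    ([annihilator_pos_normal_form]).  Summation by parts then writes [a] in
    terms of the differences of consecutive generators, with the partial sums
    of the [p_y] as coefficients ([annihilator_pos_span]).  These coefficients
    are unique because the form for the weight [1] on the generators of index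
    at most [i], [0] on the others, is dual to the family of differences: it
    returns the i-th coefficient ([threshold_form_coord]).  The three
    descriptions of the annihilator are consequences of this. *)

Set Implicit Arguments.
Unset Strict Implicit.
Unset Printing Implicit Defensive.

Import GRing.Theory.
Local Open Scope ring_scope.
Local Open Scope classical_set_scope.

(** * Submodules, annihilators and generated subalgebras *)

Section LeftModules.
Variable R : pzRingType.

(** Writing each summand as a coefficient times [b i] turns two decompositions
    of the same element into two families of coordinates of it, which agree. *)
Lemma free_left_basis_direct_sum (K M : set R) (I : finType) (b : I -> R) :
  free_left_basis K M b -> internal_direct_sum M (fun i => [set c * b i | c in K]).
Proof.
case=> [[M0 MD MK] Mb uniq_coord].
have coordP (c : {ffun I -> R}) : (forall i, [set d * b i | d in K] (c i)) ->
    exists d : {ffun I -> R}, (forall i, K (d i)) /\ forall i, c i = d i * b i.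
  move=> /= /fin_all_exists2[d Kd cE].
  by exists [ffun i => d i]; split=> i; rewrite ffunE.
have sumM (c : {ffun I -> R}) :
    (forall i, [set d * b i | d in K] (c i)) -> M (\sum_i c i).
  move=> cP; apply: (big_ind M) => // i _.
  by have [d Kd <-] := cP i; apply: MK.
split=> [|c c' cP cP' eq_cc'].
  apply/seteqP; split=> [m /uniq_coord[d [[Kd ->] _]] | _ [c cP <-]]; last exact: sumM.
  exists [ffun i => d i * b i]; first by move=> i; rewrite ffunE; exists (d i).
  by apply: eq_bigr => i _; rewrite ffunE.
have [d [Kd cE]] := coordP _ cP; have [d' [Kd' cE']] := coordP _ cP'.
have [e [_ eP]] := uniq_coord _ (sumM _ cP).
have dE : e = d by apply: eP; split=> //; apply: eq_bigr => i _.
have dE' : e = d' by apply: eP; split=> //; rewrite eq_cc'; apply: eq_bigr => i _.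
by apply/ffunP=> i; rewrite cE cE' -dE -dE'.
Qed.

Lemma left_annihilator_ideal (S : set R) : left_ideal (left_annihilator S).
Proof.
split=> [y _|a b aS bS y yS|c a aS y yS]; first by rewrite mul0r.
  by rewrite mulrDl aS ?bS ?addr0.
by rewrite -mulrA aS ?mulr0.
Qed.

Lemma left_ideal_submodule (K J : set R) : left_ideal J -> left_submodule K J.
Proof. by case=> J0 JD JM; split=> // c a _; apply: JM. Qed.

End LeftModules.

Lemma subalgebra_gen1 (k : comNzRingType) (A : algType k) (x : A) :
  subalgebra_gen [set x] = range (horner_alg x).
Proof.
apply/seteqP; split.
  apply: smallest_sub; last by move=> _ ->; exists 'X; rewrite ?horner_algX.
  split=> [|c _ _ /set_mem[p _ <-] /set_mem[q _ <-] |
            _ _ /set_mem[p _ <-] /set_mem[q _ <-]].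
  - by rewrite -(rmorph1 (horner_alg x)); apply/mem_set/imageT.
  - apply/mem_set; exists (c%:P * p + q) => //.
    by rewrite rmorphD rmorphM /= horner_algC mulr_algl.
  - by apply/mem_set; exists (p * q) => //; rewrite rmorphM.
move=> _ [p _ <-] B [[B1 BZ BM] xB]; apply: set_mem.
have B0 : 0 \in B by rewrite -[0](subrr (1 : A)) -scaleN1r addrC BZ.
have xB' : x \in B by apply/mem_set/xB.
elim/poly_ind: p => [|p c IHp]; first by rewrite rmorph0.
by rewrite rmorphD rmorphM /= horner_algX horner_algC addrC BZ ?BM.
Qed.

(** * Differences of consecutive terms *)

Lemma telescope_ord (V : zmodType) n (g : 'I_n -> V) (j last : 'I_n) :
  last = n.-1 :> nat ->
  g j - g last = \sum_(i < n.-1 | (j <= i)%N) (g (ord_low i) - g (ord_high i)).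
Proof.
move=> lastE; pose G i := g (insubd j i).
have GE (i : 'I_n) : G i = g i by rewrite /G valKd.
rewrite -!GE lastE; have le_j : (j <= n.-1)%N by rewrite -ltnS (ltn_predK (ltn_ord j)).
rewrite -[LHS]opprB -telescope_sumr // -sumrN big_nat_cond.
rewrite (big_nat_widenl _ 0) // big_mkord /=.
apply: eq_big => [i | i _]; first by rewrite ltn_ord !andbT andbb.
by rewrite opprB -(GE (ord_low i)) -(GE (ord_high i)).
Qed.

(** As the [p j] add up to [0], each [g j] may be replaced by its difference
    with the last term, which telescopes. *)
Lemma sum_by_parts (R : pzRingType) n (p g : 'I_n -> R) :
    \sum_j p j = 0 ->
  \sum_j p j * g j =
  \sum_(i < n.-1) (\sum_(j < n | (j <= i)%N) p j) * (g (ord_low i) - g (ord_high i)).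
Proof.
case: n p g => [|n] p g p0; first by rewrite !big_ord0.
transitivity (\sum_j p j * (g j - g ord_max)).
  under [RHS]eq_bigr => j _ do rewrite mulrBr.
  by rewrite sumrB -mulr_suml p0 mul0r subr0.
under eq_bigr => j _ do
  rewrite (telescope_ord g j (erefl : ord_max = n :> nat)) mulr_sumr.
rewrite (exchange_big_dep xpredT) //=; apply: eq_bigr => i _.
by rewrite mulr_suml.
Qed.

(** The weight [j <= i] takes the same value on [ord_low j] and [ord_high j]
    unless [j = i], so [lam] kills all the differences but the i-th. *)
Lemma threshold_form_coord (k : comNzRingType) (B : algType k) n
    (x : 'I_n -> B) (z : B) (i : 'I_n.-1) (lam : {additive B -> {poly k}}) :
    (forall p j, lam (horner_alg z p * x j) = p * (j <= i)%N%:R) ->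
  forall q : 'I_n.-1 -> {poly k},
    lam (\sum_j horner_alg z (q j) * (x (ord_low j) - x (ord_high j))) = q i.
Proof.
move=> lamE q; have lam_diff p j :
    lam (horner_alg z p * (x (ord_low j) - x (ord_high j))) =
    p * ((j <= i)%N%:R - (j < i)%N%:R).
  by rewrite mulrBr raddfB !lamE -mulrBr.
rewrite raddf_sum (bigD1 i) //= lam_diff leqnn ltnn subr0 mulr1.
rewrite big1 ?addr0 // => j ij.
by rewrite lam_diff leq_eqVlt (inj_eq val_inj) (negPf ij) subrr mulr0.
Qed.

(** * Families whose products do not depend on the left factor *)

Section ConstantLeftMultiplication.
Variables (k : comNzRingType) (B : algType k) (I : finType) (x : I -> B).
Hypothesis xM : forall y z t, x y * x t = x z * x t.

(** Every letter but the last is followed by another one, hence can be replaced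
    by [x0]. *)
Lemma word_normal_form (x0 : I) (s : seq I) :
  s != [::] -> exists m t, \prod_(y <- s) x y = x x0 ^+ m * x t.
Proof.
elim: s => [//|y s IHs] _; rewrite big_cons.
have [-> | /IHs[m [t ->]]] := eqVneq s [::].
  by exists 0%N, y; rewrite big_nil mulr1 mul1r.
(* [y] is followed by [t] if [m = 0], by [x0] otherwise. *)
exists m.+1, t; case: m => [|m]; first by rewrite mul1r expr1.
by rewrite !exprS !mulrA (xM y x0).
Qed.

(** Right multiplication by [x x0] merges all the terms [p y] into one
    polynomial in [x x0], which is why annihilation only constrains [c] and the
    sum of the [p y]. *)
Lemma normal_formM (x0 : I) (c : k) (p : I -> {poly k}) :
  (c%:A + \sum_y horner_alg (x x0) (p y) * x y) * x x0 =
  horner_alg (x x0) ((c%:P + (\sum_y p y) * 'X) * 'X).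
Proof.
rewrite rmorphM rmorphD rmorphM rmorph_sum /= horner_algX horner_algC !mulrDl.
congr (_ + _); rewrite !mulr_suml; apply: eq_bigr => y _.
by rewrite -!mulrA (xM y x0).
Qed.

End ConstantLeftMultiplication.

(** * Universal properties and the annihilator for an arbitrary solution *)

(** The scalars act on [B] through a central morphism [iota] rather than an
    algebra structure over [k], so that [B] can be a matrix ring over
    [{poly k}]. *)
Lemma free_lift (k : fieldType) (X : choiceType) (B : nzRingType)
    (iota : {rmorphism k -> B}) (g : X -> B) :
    (forall c b, GRing.comm (iota c) b) ->
  exists e : {rmorphism free_algebra k X -> B},
    (forall c, e c%:A = iota c) /\ (forall y, e (free_gen k y) = g y).
Proof.
move=> iotaC.
pose h (w : {fmonom X}) := \prod_(y <- (w : seq X)) g y.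
have hM : mmorphism h.
  by split=> [v w|]; rewrite /h ?fm1 ?big_nil // fmM big_cat.
pose h' := HB.pack_for (MMorphism.type {fmonom X} B) h (isMultiplicative.Build _ _ h hM).
pose e : free_algebra k X -> B := mmap iota h'.
have eB : zmod_morphism e by move=> p q; apply: mmapB.
have eM : monoid_morphism e.
  have [mM m1] := @commr_mmap_is_multiplicative _ _ _ iota h' (fun _ _ _ => iotaC _ _).
  by split.
pose e' := HB.pack_for {rmorphism free_algebra k X -> B} e
  (GRing.isZmodMorphism.Build _ _ e eB) (GRing.isMonoidMorphism.Build _ _ e eM).
exists e'; split=> [c | y] /=.
  by rewrite /e mmapZ mmap1 mulr1.
by rewrite /e mmapU /= rmorph1 mul1r /= /h fmU big_seq1.
Qed.

Section YangBaxter.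
Variables (k : fieldType) (X : choiceType) (r : X * X -> X * X).
Local Notation A := (yb_algebra k r).
Local Notation x := (yb_gen k r).

Lemma yb_genM (y z : X) : x y * x z = x (r (y, z)).1 * x (r (y, z)).2.
Proof.
rewrite -!(rmorphM (@yb_pi k X r)); apply/yb_piP.
by apply: sub_gen_smallest; exists (y, z).
Qed.

Lemma yb_pi_words (p : free_algebra k X) :
  yb_pi r p = \sum_(w <- msupp p) p@_w *: \prod_(y <- (w : seq X)) x y.
Proof.
rewrite {1}[p](monalgE p) raddf_sum; apply: eq_bigr => w _.
have wordE : << w >> = \prod_(y <- (w : seq X)) free_gen k y.
  case: w => s; elim: s => [|y s IHs]; first by rewrite big_nil -fmoneE.
  rewrite big_cons -IHs /free_gen [RHS]malgM_def fgmulUU mulr1.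
  by congr << _ >>; apply/eqP; rewrite fmP fmM fmU.
have scaleE : << p@_w *g w >> = p@_w *: << w >> :> {malg k[{fmonom X}]}.
  by rewrite -mul_malgC malgM_def fgmulUU mulr1 mul1m.
by rewrite scaleE wordE /= linearZ /= rmorph_prod.
Qed.

Lemma yb_lift (B : nzRingType) (iota : {rmorphism k -> B}) (g : X -> B) :
    (forall c b, GRing.comm (iota c) b) ->
    (forall y z, g y * g z = g (r (y, z)).1 * g (r (y, z)).2) ->
  exists psi : {rmorphism A -> B},
    (forall c, psi c%:A = iota c) /\ (forall y, psi (x y) = g y).
Proof.
move=> iotaC gr; have [e [eC eU]] := free_lift g iotaC.
have ker p : yb_ideal r p -> e p = 0.
  apply: (smallest_sub (X := [set p | e p = 0])) => [|_ [[y z] _ <-]] /=.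
    split; first split; rewrite /=.
    - exact: rmorph0.
    - by move=> q q' q0 q'0; rewrite rmorphD q0 q'0 addr0.
    - by move=> q q' q'0; rewrite rmorphM q'0 mulr0.
    - by move=> q q' q0; rewrite rmorphM q0 mul0r.
  by rewrite rmorphB [X in X - _]rmorphM [X in _ - X]rmorphM /= 4!eU gr subrr.
pose psi (a : A) := e (yb_repr a).
have psi_pi p : psi (yb_pi r p) = e p.
  by apply/eqP; rewrite -subr_eq0 -rmorphB; apply/eqP/ker/yb_piP; rewrite yb_reprK.
have psiB : zmod_morphism psi.
  by move=> a b; rewrite -[a]yb_reprK -[b]yb_reprK -raddfB !psi_pi rmorphB.
have psiM : monoid_morphism psi.
  split=> [|a b]; first by rewrite -(rmorph1 e) -psi_pi rmorph1.
  by rewrite -[a]yb_reprK -[b]yb_reprK -rmorphM !psi_pi rmorphM.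
pose psi' := HB.pack_for {rmorphism A -> B} psi
  (GRing.isZmodMorphism.Build _ _ psi psiB) (GRing.isMonoidMorphism.Build _ _ psi psiM).
exists psi'; split=> [c | y] /=; last by rewrite psi_pi eU.
by rewrite -(rmorph1 (@yb_pi k X r)) -linearZ psi_pi eC.
Qed.

(** An element of positive degree is a combination of nonempty words, each of
    which starts with a generator. *)
Lemma annihilator_posP (a : A) :
  left_annihilator (yb_pos k r) a <-> forall y, a * x y = 0.
Proof.
split=> [annPos y | annGen _ [N [c [cP ->]]]].
  apply: annPos; exists 2, (fun d => if d == 1 then x y else 0).
  split=> [d |]; last by rewrite big_nat1.
  case: eqP => [-> | _].
    exists (free_gen k y) => // w.
    by rewrite msuppU1 inE => /eqP->; rewrite fdegU.
  by exists 0; rewrite ?raddf0 // => w; rewrite msupp0 inE.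
rewrite mulr_sumr big_nat_cond big1 // => d /andP[/andP[d_gt0 _] _].
have [p p_hom <-] := cP d; rewrite yb_pi_words mulr_sumr big1_seq // => w /andP[_ w_p].
have := p_hom w w_p; rewrite fdegE; case: (w : seq X) => [|y s] /= sE.
  by rewrite -sE in d_gt0.
by rewrite big_cons -scalerAr mulrA annGen mul0r scaler0.
Qed.

End YangBaxter.

(** * The permutation idempotent algebra *)

Section PermutationIdempotent.
Variables (k : fieldType) (X : finType) (f : {perm X}).
Local Notation r := (perm_idempotent_solution f).
Local Notation A := (yb_algebra k r).
Local Notation x := (yb_gen k r).

(** Both products equal [x (f t) * x t]. *)
Lemma gen_mul_indep (y z t : X) : x y * x t = x z * x t.
Proof. by rewrite yb_genM [RHS]yb_genM. Qed.

Lemma normal_form (x0 : X) (a : A) :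
  exists (c : k) (p : X -> {poly k}),
    a = c%:A + \sum_y horner_alg (x x0) (p y) * x y.
Proof.
rewrite -[a]yb_reprK yb_pi_words.
apply: (big_ind
  (fun a => exists c p, a = c%:A + \sum_y horner_alg (x x0) (p y) * x y)).
- exists 0, (fun=> 0); rewrite scale0r add0r big1 // => y _.
  by rewrite rmorph0 mul0r.
- move=> _ _ [c [p ->]] [d [q ->]]; exists (c + d), (fun y => p y + q y).
  rewrite scalerDl addrACA -big_split; congr (_ + _); apply: eq_bigr => y _ /=.
  by rewrite rmorphD mulrDl.
move=> w _; set c := _ @_ _; have [-> | ] := eqVneq (w : seq X) [::].
  exists c, (fun=> 0); rewrite big_nil big1 ?addr0 // => y _.
  by rewrite rmorph0 mul0r.
move=> /(word_normal_form (@gen_mul_indep) x0)[m [t ->]].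
exists 0, (fun y => if y == t then c%:P * 'X^m else 0).
rewrite scale0r add0r (bigD1 t) //= big1 => [|y /negPf->]; last first.
  by rewrite rmorph0 mul0r.
by rewrite eqxx rmorphM rmorphXn /= horner_algC horner_algX addr0 mulr_algl scalerAl.
Qed.

(** The terms [p(x0) x_y] are independent for different [y]: this is tested by
    a representation in upper triangular matrices, where left multiplication by
    any generator acts on the images of the generators as the scalar ['X]. *)
Lemma linear_form (x0 : X) (w : X -> {poly k}) :
  exists lam : {additive A -> {poly k}},
    forall p y, lam (horner_alg (x x0) p * x y) = p * w y.
Proof.
(* [g y] has rows [('X, w y)] and [(0, 0)]. *)
pose g y : 'M[{poly k}]_2 := 'X *: delta_mx 0 0 + w y *: delta_mx 0 1.
have gM y z : g y * g z = 'X *: g z.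
  rewrite /g mulrDl -!scalerAl !mulrDr -!scalerAr -!mulmxE !mul_delta_mx_cond /=.
  by rewrite !(mulr1n, mulr0n, scaler0, addr0).
pose iota : {rmorphism k -> 'M[{poly k}]_2} := @scalar_mx _ 2 \o polyC.
have iotaC c b : GRing.comm (iota c) b by rewrite /GRing.comm -!mulmxE scalar_mxC.
have [|psi [psiC psi_x]] := @yb_lift k X r _ iota g iotaC.
  by move=> y z; rewrite !gM.
pose lam a : {poly k} := psi a 0 1.
have lamB : zmod_morphism lam by move=> a b; rewrite /lam rmorphB !mxE.
pose lam' := HB.pack_for {additive A -> {poly k}} lam
  (GRing.isZmodMorphism.Build _ _ lam lamB).
exists lam' => p y; suff psi_px : psi (horner_alg (x x0) p * x y) = p *: g y.
  by rewrite /= /lam psi_px !mxE /= mulr0 mulr1 add0r.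
rewrite rmorphM psi_x /=; elim/poly_ind: p => [|p c IHp].
  by rewrite rmorph0 rmorph0 mul0r scale0r.
rewrite !rmorphD !rmorphM /= horner_algX horner_algC psi_x psiC mulrDl -mulrA gM.
by rewrite -scalerAr IHp scalerA mulrC scalerDl /iota /= -mulmxE mul_scalar_mx.
Qed.

Lemma horner_gen_inj (x0 : X) : injective (horner_alg (x x0)).
Proof.
move=> p q pq; have [lam lamE] := linear_form x0 (fun=> 1).
by rewrite -[p]mulr1 -[q]mulr1 -(lamE p x0) pq lamE.
Qed.

Lemma annihilator_pos_normal_form (x0 : X) (a : A) :
    left_annihilator (yb_pos k r) a ->
  exists2 p : X -> {poly k},
    \sum_y p y = 0 & a = \sum_y horner_alg (x x0) (p y) * x y.
Proof.
move=> /annihilator_posP/(_ x0); have [c [p ->]] := normal_form x0 a => ax0.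
have : (c%:P + (\sum_y p y) * 'X) * 'X = 0.
  apply: (@horner_gen_inj x0); rewrite rmorph0 -[RHS]ax0.
  by rewrite (normal_formM (@gen_mul_indep)).
move=> /eqP; rewrite mulf_eq0 polyX_eq0 orbF => /eqP cp0.
have c0 : c = 0.
  by have /(congr1 (coefp 0)) := cp0; rewrite /= coefD coefC coefMX coef0 addr0.
exists p; last by rewrite c0 scale0r add0r.
by move: cp0 => /eqP; rewrite c0 add0r mulf_eq0 polyX_eq0 orbF => /eqP.
Qed.

End PermutationIdempotent.

(** * The basis of differences *)

Section AnnihilatorBasis.
Variables (k : fieldType) (n : nat) (f : {perm 'I_n}) (x0 : 'I_n).
Local Notation r := (perm_idempotent_solution f).
Local Notation A := (yb_algebra k r).
Local Notation x := (yb_gen k r).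
Local Notation b := (fun i : 'I_n.-1 => x (ord_low i) - x (ord_high i)).

Lemma annihilator_pos_gen (i : 'I_n.-1) : left_annihilator (yb_pos k r) (b i).
Proof.
apply/annihilator_posP => y.
by rewrite mulrBl (gen_mul_indep k f (ord_low i) (ord_high i)) subrr.
Qed.

Lemma annihilator_pos_span (a : A) :
    left_annihilator (yb_pos k r) a ->
  exists q : 'I_n.-1 -> {poly k}, a = \sum_i horner_alg (x x0) (q i) * b i.
Proof.
move=> /(annihilator_pos_normal_form x0)[p p0 ->].
exists (fun i => \sum_(j < n | (j <= i)%N) p j).
have /(@sum_by_parts A n _ x)-> : \sum_j horner_alg (x x0) (p j) = 0.
  by rewrite -rmorph_sum p0 rmorph0.
by apply: eq_bigr => i _; rewrite -rmorph_sum.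
Qed.

Lemma annihilator_pos_coord_uniq (q q' : 'I_n.-1 -> {poly k}) :
    \sum_i horner_alg (x x0) (q i) * b i = \sum_i horner_alg (x x0) (q' i) * b i ->
  q =1 q'.
Proof.
move=> qq' i; have [lam lamE] := linear_form f x0 (fun j => (j <= i)%N%:R : {poly k}).
by rewrite -(threshold_form_coord lamE q) qq' (threshold_form_coord lamE q').
Qed.

Lemma annihilator_pos_basis :
  free_left_basis (range (horner_alg (x x0))) (left_annihilator (yb_pos k r)) b.
Proof.
split; [exact/left_ideal_submodule/left_annihilator_ideal | exact: annihilator_pos_gen |].
move=> _ /annihilator_pos_span[q ->].
exists [ffun i => horner_alg (x x0) (q i)]; split=> [|c [cP]].
  split=> [i|]; first by rewrite ffunE.
  by apply: eq_bigr => i _; rewrite ffunE.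
have [q' _ cE] := fin_all_exists2 cP.
under [RHS]eq_bigr => i _ do rewrite -cE.
by move=> /annihilator_pos_coord_uniq qq'; apply/ffunP=> i; rewrite ffunE qq'.
Qed.

Lemma annihilator_pos_left_ideal :
  left_annihilator (yb_pos k r) = left_ideal_gen (range b).
Proof.
apply/seteqP; split; last first.
  apply: smallest_sub => [|_ [i _ <-]]; last exact: annihilator_pos_gen.
  exact: left_annihilator_ideal.
move=> _ /annihilator_pos_span[q ->] J [[J0 JD JM] bJ].
by apply: (big_ind J) => // i _; apply/JM/bJ/imageT.
Qed.

End AnnihilatorBasis.

Theorem proposition5p3 (k : fieldType) (n : nat) (hn : (1 < n)%N)
    (f : {perm 'I_n}) :
  let r := perm_idempotent_solution f in
  let A : algType k := yb_algebra k r in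
  let x : 'I_n -> A := yb_gen k r in
  let x1 : A := x (Ordinal (ltnW hn)) in
  let kx1 : set A := subalgebra_gen [set x1] in
  let Ann : set A := left_annihilator (yb_pos k r) in
  let b : 'I_n.-1 -> A := fun i => x (ord_low i) - x (ord_high i) in
  [/\ Ann = left_ideal_gen (range b),
      polynomial_subalgebra x1 kx1,
      free_left_basis kx1 Ann b
    & internal_direct_sum Ann (fun i => [set c * b i | c in kx1])].
Proof.
move=> r A x x1 kx1 Ann b.
have kx1E : kx1 = range (horner_alg x1) by apply: subalgebra_gen1.
have basis : free_left_basis kx1 Ann b by rewrite kx1E; apply: annihilator_pos_basis.
have ideal : Ann = left_ideal_gen (range b).
  exact: (annihilator_pos_left_ideal k f (Ordinal (ltnW hn))).
split; [exact: ideal | | exact: basis |].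
  by split; [exact: horner_gen_inj | rewrite kx1E].
exact: free_left_basis_direct_sum basis.
Qed.
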